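(* For all integers $n\ge1$ and $s\ge1$, $$\left\lceil\!\!\left\lceil\begin{matrix} n\\ n-1\end{matrix}\right\rceil\!\!\right\rceil_{s}=\frac{1}{2^{s-1}}\left\lfloor\!\!\left\lfloor\begin{matrix} n\\ n-1\end{matrix}\right\rfloor\!\!\right\rfloor_{s}.$$
   Context: For a partition $\pi=\{b_1,\dots,b_k\}$ of $[n]=\{1,\dots,n\}$ into non-empty blocks, $\operatorname{bl}\pi=\{\min b_1,\dots,\min b_k\}$ (minima with respect to the usual order of integers). A list is a linearly ordered block. The Lah number with higher level (level $s$), $\left\lfloor\!\!\left\lfloor\begin{matrix} n\\ k\end{matrix}\right\rfloor\!\!\right\rfloor_{s}$, is the number of ordered $s$-tuples $(\pi_1,\dots,\pi_s)$ of partitions of $[n]$ into $k$ non-empty lists with $\operatorname{bl}\pi_1=\dots=\operatorname{bl}\pi_s$. The Stirling number of the first kind with higher level, $\left[\!\left[\begin{matrix} n\\ k\end{matrix}\right]\!\right]_{s}$ (resp. of the second kind, $\left\{\!\left\{\begin{matrix} n\\ k\end{matrix}\right\}\!\right\}_{s}$), is the number of ordered $s$-tuples $(\pi_1,\dots,\pi_s)$ of partitions of $[n]$ into $k$ non-empty cyclically ordered blocks (resp. $k$ non-empty unordered blocks) with $\operatorname{bl}\pi_1=\dots=\operatorname{bl}\pi_s$. Equivalently (known), they are determined for $n,k\ge1$ by $\left[\!\left[\begin{matrix} n\\ k\end{matrix}\right]\!\right]_{s}=\left[\!\left[\begin{matrix} n-1\\ k-1\end{matrix}\right]\!\right]_{s}+(n-1)^s\left[\!\left[\begin{matrix}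 n-1\\ k\end{matrix}\right]\!\right]_{s}$ and $\left\{\!\left\{\begin{matrix} n\\ k\end{matrix}\right\}\!\right\}_{s}=\left\{\!\left\{\begin{matrix} n-1\\ k-1\end{matrix}\right\}\!\right\}_{s}+k^s\left\{\!\left\{\begin{matrix} n-1\\ k\end{matrix}\right\}\!\right\}_{s}$, both being $1$ at $(n,k)=(0,0)$ and $0$ at $(n,0)$ and $(0,n)$ for $n>0$. The Lah numbers of order $s$ are defined for integers $n,k\ge0$, $s\ge1$ by $$\left\lceil\!\!\left\lceil\begin{matrix} n\\ k\end{matrix}\right\rceil\!\!\right\rceil_{s}=\sum_{j=k}^{n}\left[\!\left[\begin{matrix} n\\ j\end{matrix}\right]\!\right]_{s}\left\{\!\left\{\begin{matrix} j\\ k\end{matrix}\right\}\!\right\}_{s},$$ and are $0$ for $n<k$. *)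

(* Defs.v *)
From mathcomp Require Import all_boot all_order all_algebra all_fingroup.

Set Implicit Arguments.
Unset Strict Implicit.
Unset Printing Implicit Defensive.

(* The set [n] is rendered as 'I_n, so element i of 'I_n stands for i + 1. *)

Definition block_minima (n : nat) (P : {set {set 'I_n}}) : {set 'I_n} :=
  [set i | [exists B in P, (i \in B) && [forall j in B, (i <= j)%N]]].

(* T is a type of encodings of partitions of [n] whose blocks may carry extra
   structure: valid singles out the actual encodings, and blocks forgets the
   extra structure. *)
Definition same_minima_count (n : nat) (T : finType) (valid : pred T)
    (blocks : T -> {set {set 'I_n}}) (s k : nat) : nat :=
  #|[set t : s.-tuple T |
      [forall i, valid (tnth t i) && (#|blocks (tnth t i)| == k)]
      && [forall i, forall j,
            block_minima (blocks (tnth t i))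
            == block_minima (blocks (tnth t j))]]|.

Definition is_set_partition (n : nat) (P : {set {set 'I_n}}) : bool :=
  partition P [set: 'I_n].

Definition stirling2 (s n k : nat) : nat :=
  same_minima_count (@is_set_partition n) id s k.

(* A partition into cyclically ordered blocks is encoded by its successor map,
   i.e. a permutation of [n]: its blocks are the orbits, and the cyclic order
   on each block B is x, p x, p (p x), and so on. Every permutation arises from
   exactly one such partition. *)
Definition stirling1 (s n k : nat) : nat :=
  same_minima_count (fun _ : 'S_n => true) (fun p : 'S_n => porbits p) s k.

(* A list on a block is the duplicate-free sequence of its elements; its length
   is at most n, whence the finite type {bseq n of 'I_n}. *)
Definition list_support (n : nat) (l : {bseq n of 'I_n}) : {set 'I_n} :=
  [set x in l].

Definition list_blocks (n : nat) (L : {set {bseq n of 'I_n}}) :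
    {set {set 'I_n}} :=
  [set list_support l | l in L].

(* The injectivity condition says that each block carries only one order;
   partition already excludes the empty list. *)
Definition is_list_partition (n : nat) (L : {set {bseq n of 'I_n}}) : bool :=
  [&& [forall l in L, uniq l],
      dinjectiveb (@list_support n) [in L]
    & partition (list_blocks L) [set: 'I_n]].

Definition lah_level (s n k : nat) : nat :=
  same_minima_count (@is_list_partition n) (@list_blocks n) s k.

Definition lah_order (s n k : nat) : nat :=
  (\sum_(k <= j < n.+1) stirling1 s n j * stirling2 s j k)%N.

(* Main.v *)
Require Import Defs.
From mathcomp Require Import all_boot all_order all_algebra all_fingroup.

(** Split a tuple of structured partitions according to its tuple of underlying
    set partitions.  The condition on block minima only sees the latter, so if
    every partition of [n] into k blocks carries exactly c structures, then the
    structured count is c ^ s times the level-s Stirling number of the second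
    kind S(n, k) ([same_minima_count_fibers]).

    Take k = n - 1.  The number of block elements beyond the first of each
    block is n - k = 1 ([partition_excess]), so one block is a pair and the
    others are singletons.  Such a partition carries a single cyclic
    structure ([stirling1_eq_stirling2]) and two list structures
    ([lah_level_codim1]).  Hence the level-s numbers of the first and second
    kind agree at (n, n - 1), while the Lah number with level s is
    2 ^ s S(n, n - 1).  The sum defining the Lah number of order s has just the
    terms j = n - 1 and j = n, and the diagonal Stirling numbers are 1, so its
    value is 2 S(n, n - 1) ([lah_order_codim1]).  The quotient is 2 ^ (s - 1),
    and S(n, n - 1) never has to be computed. *)

Set Implicit Arguments.
Unset Strict Implicit.
Unset Printing Implicit Defensive.

Import GRing.Theory.

(** * Partitions of a finite type with few elements in excess of blocks *)

Lemma card_block_gt0 (T : finType) (P : {set {set T}}) B :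
  partition P [set: T] -> B \in P -> 0 < #|B|.
Proof.
by move=> pP; rewrite card_gt0; apply: contraTneq => ->; rewrite (partition0 pP).
Qed.

(** Setting aside one element of every block leaves [#|T| - #|P|] elements.  When
    this difference is 0 or 1, the block sizes are known up to order. *)
Lemma partition_excess (T : finType) (P : {set {set T}}) :
  partition P [set: T] -> (\sum_(B in P) #|B|.-1 + #|P| = #|T|)%N.
Proof.
move=> pP; rewrite -cardsT (card_partition pP) -sum1_card -big_split /=.
by apply: eq_bigr => B PB; rewrite addn1 prednK ?(card_block_gt0 pP).
Qed.

Lemma card_block_le2 (T : finType) (P : {set {set T}}) B :
  partition P [set: T] -> #|T| <= #|P|.+1 -> B \in P -> #|B| <= 2.
Proof.
move=> pP; rewrite -(partition_excess pP) addnC -addn1 leq_add2l => le1 PB.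
have : #|B|.-1 <= 1 by apply: leq_trans le1; rewrite (bigD1 B) //= leq_addr.
by case: #|B| => [|[|[]]].
Qed.

Definition singletons (T : finType) : {set {set T}} := [set [set x] | x : T].

Lemma card_singletons (T : finType) : #|singletons T| = #|T|.
Proof. by rewrite card_imset //; apply: set1_inj. Qed.

Lemma partition_singletons (T : finType) : partition (singletons T) [set: T].
Proof.
apply/and3P; split.
- apply/eqP/setP=> x; rewrite inE; apply/bigcupP; exists [set x]; last exact: set11.
  exact: imset_f.
- apply/trivIsetP=> _ _ /imsetP[x _ ->] /imsetP[y _ ->] xy.
  by rewrite disjoints1 inE; apply: contra xy => /eqP->.
- by apply/imsetP=> -[x _ /setP/(_ x)]; rewrite !inE eqxx.
Qed.

Lemma partition_max_card (T : finType) (P : {set {set T}}) :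
  partition P [set: T] -> #|P| = #|T| -> P = singletons T.
Proof.
move=> pP cP; apply/eqP; rewrite eqEcard cP card_singletons leqnn andbT.
apply/subsetP=> B PB; have : \sum_(A in P) #|A|.-1 = 0.
  by apply/eqP; rewrite -(eqn_add2r #|P|) (partition_excess pP) cP.
move/eqP; rewrite sum_nat_eq0 => /forall_inP/(_ B PB) B1.
have : #|B| == 1 by rewrite -(prednK (card_block_gt0 pP PB)) (eqP B1).
by case/cards1P=> x ->; apply: imset_f.
Qed.

(** * Counting tuples of structures over tuples of partitions *)

Lemma card_tuple_prod (T : finType) s (F : 'I_s -> {set T}) :
  #|[set t : s.-tuple T | [forall i, tnth t i \in F i]]| = \prod_(i < s) #|F i|.
Proof.
transitivity #|(family F : simpl_pred {ffun 'I_s -> T})|; last first.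
  by rewrite card_family foldrE big_image.
rewrite -(card_imset _ (can_inj (@finfun_of_tupleK _ _))).
apply: eq_card => f; apply/imsetP/familyP => [[t] | fF].
  by rewrite inE => /forallP tF -> i; rewrite /finfun_of_tuple ffunE; apply: tF.
exists (tuple_of_finfun f); last by rewrite tuple_of_finfunK.
by rewrite inE; apply/forallP => i; rewrite tnth_mktuple; apply: fF.
Qed.

(** The defining conditions on a tuple of encodings depend only on the tuple of
    their underlying partitions, apart from validity, which is checked entry by
    entry.  Each fibre over an admissible tuple of partitions is therefore a
    product of s sets of size c. *)
Lemma same_minima_count_fibers n (T : finType) (valid : pred T)
    (blocks : T -> {set {set 'I_n}}) s k c :
    (forall x, valid x -> is_set_partition (blocks x)) ->
    (forall P, is_set_partition P -> #|P| = k ->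
       #|[set x | valid x & blocks x == P]| = c) ->
  same_minima_count valid blocks s k = (c ^ s * stirling2 s n k)%N.
Proof.
move=> vP fib; rewrite /stirling2 /same_minima_count mulnC -sum_nat_const -sum1_card.
rewrite (partition_big (fun t : s.-tuple T => map_tuple blocks t) [in
   [set u : s.-tuple {set {set 'I_n}} |
      [forall i, is_set_partition (tnth u i) && (#|tnth u i| == k)]
      && [forall i, forall j,
            block_minima (tnth u i) == block_minima (tnth u j)]]]) /=.
  apply: eq_bigr => u; rewrite inE => /andP[/forallP uP /forallP um].
  transitivity (\prod_(i < s) #|[set x | valid x & blocks x == tnth u i]|); last first.
    rewrite -[s in RHS]card_ord -prod_nat_const; apply: eq_bigr => i _.
    by have /andP[Pi /eqP ci] := uP i; apply: fib.
  rewrite -card_tuple_prod sum1_card; apply: eq_card => t; rewrite !inE unfold_in inE.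
  apply/andP/forallP => [[/andP[/forallP tv _] /eqP tu] i | tF].
    by have /andP[vi _] := tv i; rewrite inE vi -tu tnth_map eqxx.
  have tu : map_tuple blocks t = u.
    by apply/eq_from_tnth => i; have := tF i; rewrite inE tnth_map => /andP[_ /eqP].
  rewrite tu eqxx; split=> //; apply/andP; split; apply/forallP=> i.
    have := tF i; have /andP[_ ci] := uP i.
    by rewrite inE => /andP[-> /eqP->].
  by have := um i; rewrite -tu tnth_map; under eq_forallb => j do rewrite tnth_map.
move=> t; rewrite !inE => /andP[/forallP tv tm]; apply/andP; split.
  by apply/forallP=> i; have /andP[vi ci] := tv i; rewrite tnth_map ci vP.
apply/forallP=> i; apply/forallP=> j; rewrite !tnth_map.
by have /forallP/(_ i)/forallP/(_ j) := tm.
Qed.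

(** * List structures on a partition *)

Lemma card_orders n (B : {set 'I_n}) :
  #|[set l : {bseq n of 'I_n} | uniq l & list_support l == B]| = #|B|`!.
Proof.
rewrite (cardE B) -size_permutations ?enum_uniq // cardE -(size_map (@bseqval n 'I_n)).
apply: perm_size; apply: uniq_perm; rewrite ?permutations_uniq //.
  by rewrite map_inj_uniq ?enum_uniq //; apply: val_inj.
move=> l; rewrite mem_permutations; apply/mapP/idP => [[{}l + ->] | lB].
  rewrite mem_enum inE => /andP[ul /eqP <-].
  apply: uniq_perm; rewrite ?enum_uniq // => x.
  by rewrite mem_enum inE.
have sl : size l <= n.
  by rewrite (perm_size lB) -cardE -[leqRHS]card_ord max_card.
exists (Bseq sl) => //; rewrite mem_enum inE (perm_uniq lB) enum_uniq /=.
by apply/eqP/setP=> x; rewrite inE (perm_mem lB) mem_enum.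
Qed.

(** A list partition over P amounts to an independent choice, for each block of P,
    of an ordering of it: the image of P under the choice function f recovers f,
    since the support of a list tells which block it orders. *)
Lemma card_list_partitions n (P : {set {set 'I_n}}) :
  is_set_partition P ->
  #|[set L | is_list_partition L & list_blocks L == P]| = \prod_(B in P) #|B|`!.
Proof.
move=> pP; pose orders B := [set l : {bseq n of 'I_n} | uniq l & list_support l == B].
pose D := pfamily ([bseq] : {bseq n of 'I_n}) [in P] orders.
have DP (f : {ffun {set 'I_n} -> {bseq n of 'I_n}}) B :
    f \in D -> B \in P -> uniq (f B) /\ list_support (f B) = B.
  move=> /pfamilyP[_ fP] PB; have := fP B PB; rewrite inE.
  by case/andP => ? /eqP.
(* Choice functions are pinned to the empty list outside P, which makes the
   function attached to a list partition unique. *)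
transitivity #|[set f @: P | f : {ffun {set 'I_n} -> {bseq n of 'I_n}} in D]|.
  apply: eq_card => L; rewrite inE; apply/andP/imsetP => [[] | [f fD ->]].
    move=> /and3P[/forall_inP uL /dinjectiveP injL _] /eqP LP.
    have /fin_all_exists [f fP] : forall B, exists l : {bseq n of 'I_n},
        if B \in P then (l \in L) && (list_support l == B) else l == [bseq].
      move=> B; have [|_] := boolP (B \in P); last by exists [bseq].
      by rewrite -LP => /imsetP[l lL ->]; exists l; rewrite lL eqxx.
    exists (finfun f).
      apply/pfamilyP; split=> [|B PB].
        by apply/supportP=> B /negPf PB; have := fP B; rewrite PB ffunE => /eqP.
      by have := fP B; rewrite inE PB ffunE => /andP[/uL -> ->].
    apply/setP=> l; apply/idP/imsetP => [lL | [B PB ->]]; last first.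
      by have := fP B; rewrite PB ffunE => /andP[].
    have PB : list_support l \in P by rewrite -LP imset_f.
    exists (list_support l) => //; rewrite ffunE.
    have := fP (list_support l); rewrite PB => /andP[fL /eqP e]; exact: injL.
  have LP : list_blocks (f @: P) = P.
    rewrite /list_blocks -imset_comp -[RHS]imset_id.
    by apply: eq_in_imset => B PB; have [] := DP f B fD PB.
  rewrite LP; split=> //; rewrite /is_list_partition LP; apply/and3P; split=> //.
    by apply/forall_inP => _ /imsetP[B PB ->]; have [] := DP f B fD PB.
  apply/dinjectiveP => _ _ /imsetP[B PB ->] /imsetP[C PC ->].
  by have [_ ->] := DP f B fD PB; have [_ ->] := DP f C fD PC => ->.
rewrite card_in_imset.
  rewrite card_pfamily foldrE big_image; apply: eq_bigr => B PB.
  exact: card_orders.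
move=> f g fD gD fg; apply/ffunP=> B; have [PB|PB] := boolP (B \in P); last first.
  by case/pfamilyP: fD gD => /supportP f0 _ /pfamilyP[/supportP g0 _]; rewrite f0 ?g0.
have /imsetP[C PC e] : f B \in g @: P by rewrite -fg imset_f.
have [_ sB] := DP f B fD PB; have [_ sC] := DP g C gD PC.
by rewrite e; congr (g _); rewrite -sC -e sB.
Qed.

(** * Cyclic structures on a partition into blocks of size at most two *)

Lemma porbits_partition (T : finType) (p : {perm T}) :
  partition (porbits p) [set: T].
Proof.
apply/and3P; split.
- apply/eqP/setP=> x; rewrite inE; apply/bigcupP.
  by exists (porbit p x); rewrite ?imset_f ?porbit_id.
- apply/trivIsetP=> _ _ /imsetP[x _ ->] /imsetP[y _ ->].
  apply: contraR => /pred0Pn[z /andP[]] /=.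
  by rewrite -!eq_porbit_mem => /eqP-> /eqP->.
- by apply/imsetP=> -[x _ /setP/(_ x)]; rewrite porbit_id inE.
Qed.

Lemma pblock_porbits (T : finType) (p : {perm T}) x :
  pblock (porbits p) x = porbit p x.
Proof.
have /and3P[_ tI _] := porbits_partition p.
by apply: def_pblock; rewrite ?imset_f ?porbit_id.
Qed.

(** On an orbit of size at most two, a permutation either fixes the only point or
    exchanges the two points, so the orbits leave no freedom. *)
Lemma porbits_inj_le2 (T : finType) (p q : {perm T}) :
  porbits p = porbits q -> {in porbits q, forall B : {set T}, #|B| <= 2} -> p = q.
Proof.
move=> pq le2; apply/permP=> x.
have e : porbit p x = porbit q x by rewrite -!pblock_porbits pq.
have fix_eq (r r' : {perm T}) : porbit r x = porbit r' x -> r x = x -> r' x = x.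
  move=> rr' rx; have : r' x \in porbit r' x by rewrite (mem_porbit r' 1).
  rewrite -rr' => /porbitP[i ->].
  by elim: i => [|i IH]; rewrite ?perm1 // expgSr permM IH.
have [px|px] := eqVneq (p x) x; first by rewrite px (fix_eq _ _ e px).
(* If p x and q x differed, x, p x and q x would be three points of one orbit. *)
apply: contraTeq (le2 _ (imset_f _ (isT : x \in T))) => npq; rewrite -ltnNge.
have qx : q x != x by apply: contraNneq px => /(fix_eq _ _ (esym e)) ->.
rewrite (cardsD1 x) porbit_id (cardsD1 (p x)) (cardsD1 (q x)) !inE px qx.
by rewrite -e (mem_porbit p 1) e (mem_porbit q 1) eq_sym npq.
Qed.

(** The permutation is the involution that sends each element to the other one of
    its block, and fixes it if there is no other. *)
Lemma porbits_surj_le2 (T : finType) (P : {set {set T}}) :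
    partition P [set: T] -> {in P, forall B : {set T}, #|B| <= 2} ->
  exists p : {perm T}, porbits p = P.
Proof.
move=> pP le2; have /and3P[/eqP cP tI _] := pP.
have xP x : x \in pblock P x by rewrite mem_pblock cP inE.
have PxP x : pblock P x \in P by rewrite pblock_mem // cP inE.
pose f x := odflt x [pick y in pblock P x :\ x].
have fP x : pblock P x = [set x; f x].
  rewrite /f; case: pickP => [y | no_y] /=.
    rewrite !inE => /andP[yx yP]; apply/esym/eqP; rewrite eqEcard cards2 eq_sym yx.
    rewrite le2 // andbT; apply/subsetP=> z; rewrite !inE.
    by case/orP=> /eqP->; rewrite ?xP.
  apply/setP=> y; rewrite !inE orbb; have := no_y y; rewrite !inE.
  by case: eqVneq => [-> _|_ /= ->]; rewrite ?xP.
have ff x : f (f x) = x.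
  have e : pblock P (f x) = pblock P x.
    by apply: def_pblock; rewrite ?PxP // fP !inE eqxx orbT.
  have [fx|fx] := eqVneq (f x) x; first by rewrite !fx.
  have := fP (f x); rewrite e fP => /setP/(_ x).
  by rewrite !inE eqxx /= eq_sym (negPf fx) => /esym/eqP.
pose p := perm (can_inj ff); exists p.
have pE x : porbit p x = pblock P x.
  rewrite fP; apply/setP=> y; rewrite !inE; apply/porbitP/orP.
    case=> i ->; elim: i => [|i]; first by rewrite perm1; left.
    rewrite expgSr permM permE => -[] /eqP->; first by right.
    by rewrite ff; left.
  by case=> /eqP->; [exists 0; rewrite perm1 | exists 1; rewrite permE].
apply/setP=> B; apply/imsetP/idP => [[x _ ->]|PB]; first by rewrite pE.
have /card_gt0P[x xB] := card_block_gt0 pP PB.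
by exists x; rewrite // pE; apply/esym/def_pblock.
Qed.

(** * Values on the diagonal and next to it *)

(** With at least n - 1 blocks, every block has at most two elements and thus
    exactly one cyclic order. *)
Lemma stirling1_eq_stirling2 s n k : n <= k.+1 -> stirling1 s n k = stirling2 s n k.
Proof.
move=> le_nk; rewrite -[RHS]mul1n -(exp1n s).
apply: same_minima_count_fibers => [p _|P pP cP]; first exact: porbits_partition.
have le2 : {in P, forall B : {set 'I_n}, #|B| <= 2}.
  by move=> B; apply: card_block_le2; rewrite ?card_ord ?cP.
have [p pE] := porbits_surj_le2 pP le2.
apply/eqP/cards1P; exists p; apply/setP=> q; rewrite !inE /=.
apply/eqP/eqP => [qP | -> //]; apply: porbits_inj_le2; rewrite ?pE //.
Qed.

Lemma stirling2_diag s n : stirling2 s n n = 1.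
Proof.
apply/eqP/cards1P; exists (nseq_tuple s (singletons 'I_n)).
apply/setP=> t; rewrite !inE; apply/andP/eqP => [[/forallP tP _] | ->].
  apply/eq_from_tnth => i; have /andP[Pi /eqP ci] := tP i.
  by rewrite tnth_nseq; apply: partition_max_card; rewrite ?card_ord.
split; apply/forallP=> i.
  by rewrite tnth_nseq card_singletons card_ord eqxx andbT; apply: partition_singletons.
by apply/forallP=> j; rewrite !tnth_nseq.
Qed.

(** As block sizes are 1 or 2, the number [#|B|`!] of orders of a block B is
    [2 ^ (#|B| - 1)]; the product over all blocks is 2 to the power of the
    total excess, which is 1. *)
Lemma lah_level_codim1 s n :
  lah_level s n.+1 n = (2 ^ s * stirling2 s n.+1 n)%N.
Proof.
apply: same_minima_count_fibers => [L|P pP cP]; first by case/and3P.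
rewrite card_list_partitions //.
have ex : \sum_(B in P) #|B|.-1 = 1.
  by apply/eqP; rewrite -(eqn_add2r #|P|) (partition_excess pP) card_ord cP.
transitivity (2 ^ \sum_(B in P) #|B|.-1); last by rewrite ex.
rewrite expn_sum; apply: eq_bigr => B PB.
have := card_block_le2 pP _ PB; rewrite card_ord cP => /(_ (leqnn _)).
by have := card_block_gt0 pP PB; case: #|B| => [|[|[]]].
Qed.

Lemma lah_order_codim1 s n :
  lah_order s n.+1 n = (2 * stirling2 s n.+1 n)%N.
Proof.
rewrite /lah_order big_ltn // big_nat1 !stirling1_eq_stirling2 // !stirling2_diag.
by rewrite muln1 mul1n addnn mul2n.
Qed.

Theorem theorem4p3 (n s : nat) (hn : (1 <= n)%N) (hs : (1 <= s)%N) :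
  ((lah_order s n (n - 1))%:R
   = 1 / 2%:R ^+ (s - 1) * (lah_level s n (n - 1))%:R :> rat)%R.
Proof.
case: n hn => // n _; case: s hs => // s _; rewrite !subn1 /=.
rewrite lah_order_codim1 lah_level_codim1 expnS !natrM natrX.
by rewrite div1r -mulrA mulrCA mulKf // expf_neq0.
Qed.
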